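(* Let $1\to \mathbb{T}\to G\xrightarrow{\pi} W\to 1$ be an extension in which $G$ is a compact Lie group, $\mathbb{T}$ is a torus (the identity component of $G$) and $W$ is a finite group. Let $\mathrm{Sub}(G|\mathrm{full})/G$ be the set of $G$-conjugacy classes of full subgroups of $G$, and consider the map $$\mathrm{Sub}(G|\mathrm{full})/G\longrightarrow W\text{-}\mathrm{Sub}(\mathbb{T})\cong W\text{-}\mathrm{Sub}(\mathbb{T}^* )=W\text{-}\mathrm{Sub}(\Lambda^0),\qquad (H)\longmapsto (H\cap\mathbb{T})^{\dagger}.$$ Then: (1) the map is almost surjective, in the sense that there is an integer $n\ge 1$ such that every $W$-invariant closed subgroup $S\subseteq\mathbb{T}$ containing $\mathbb{T}[n]$ lies in the image (that is, $S=H\cap \mathbb{T}$ for some full subgroup $H$); (2) the map has finite fibres, of bounded cardinality.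
   Context: All subgroups of $G$ and $\mathbb{T}$ are closed. A subgroup $H\subseteq G$ is full if $\pi(H)=W$. The group $W$ acts on $\mathbb{T}$ by conjugation in $G$. $W\text{-}\mathrm{Sub}(\mathbb{T})$ is the set of $W$-invariant closed subgroups of $\mathbb{T}$. $\mathbb{T}^*=\Lambda^0=\mathrm{Hom}(\mathbb{T},U(1))\cong\mathbb{Z}^r$ is the group of continuous characters, with the induced $W$-action, and $W\text{-}\mathrm{Sub}(\Lambda^0)$ is the set of its $W$-invariant subgroups. For $S\subseteq \mathbb{T}$, $S^\dagger=\ker(\mathbb{T}^*\to S^* )$ is the group of characters trivial on $S$; the bijection $W\text{-}\mathrm{Sub}(\mathbb{T})\cong W\text{-}\mathrm{Sub}(\mathbb{T}^* )$ is $S\mapsto S^\dagger$ (Pontrjagin duality). $\mathbb{T}[n]=\{t\in\mathbb{T} : t^n=1\}$. *)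

(* Defs.v *)
From HB Require Import structures.
From mathcomp Require Import all_boot all_order all_algebra.
From mathcomp Require Import fingroup monoid complex.
From mathcomp Require Import all_classical all_reals all_analysis.
Set Implicit Arguments.
Unset Strict Implicit.
Unset Printing Implicit Defensive.
Import Order.TTheory GRing.Theory Num.Theory.
Import numFieldNormedType.Exports.
Local Open Scope classical_set_scope.
Local Open Scope ring_scope.

#[short(type="preTopologicalGroupType")]
HB.structure Definition PreTopologicalGroup := {G of Topological G & Group G}.

HB.mixin Record PreTopologicalGroup_isTopologicalGroup G
    of PreTopologicalGroup G := {
  mulg_continuous : continuous (fun x : G * G => (x.1 * x.2)%g) ;
  invg_continuous : continuous (fun x : G => x^-1%g)
}.

#[short(type="topologicalGroupType")]
HB.structure Definition TopologicalGroup :=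
  {G of PreTopologicalGroup G & PreTopologicalGroup_isTopologicalGroup G}.

Section Product.
Variables (I : Type) (G : topologicalGroupType).
Local Notation P := {ptws I -> G}.

Let oneP : P := fun=> 1%g.
Let invP (f : P) : P := fun i => (f i)^-1%g.
Let mulP (f g : P) : P := fun i => (f i * g i)%g.

Let mulPA : associative mulP.
Proof. by move=> f g h; apply/funext => i; exact: mulgA. Qed.
Let mul1P : left_id oneP mulP.
Proof. by move=> f; apply/funext => i; exact: mul1g. Qed.
Let mulP1 : right_id oneP mulP.
Proof. by move=> f; apply/funext => i; exact: mulg1. Qed.
Let mulVP : left_inverse oneP invP mulP.
Proof. by move=> f; apply/funext => i; exact: mulVg. Qed.
Let mulPV : right_inverse oneP invP mulP.
Proof. by move=> f; apply/funext => i; exact: mulgV. Qed.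

HB.instance Definition _ := isGroup.Build P mulPA mul1P mulP1 mulVP mulPV.

Lemma ptws_proj_continuous (i : I) : continuous (fun f : P => f i).
Proof.
move=> f A Afi; have /cvg_sup/(_ i) : nbhs f --> (f : P) by [].
by apply; exact: (@initial_continuous _ _ (fun g : I -> G => g i) f A Afi).
Qed.

Lemma ptws_continuous (X : topologicalType) (h : X -> P) :
  (forall i, continuous (fun x => h x i)) -> continuous h.
Proof.
move=> ch x; apply/cvg_sup => i A [_ [[B oB <-] Bhx] sBA].
have hB : nbhs (h x i) B by exact: open_nbhs_nbhs.
by apply: (@filterS _ (nbhs x) _ _ _ _ (ch i x B hB)) => y /sBA.
Qed.

Let mulP_continuous : continuous (fun x : P * P => (x.1 * x.2)%g).
Proof.
apply: ptws_continuous => i x.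
apply: (@continuous2_cvg _ _ _ _ _ _ (fun x => x.1 i) (fun x => x.2 i)).
- exact: (mulg_continuous (x.1 i, x.2 i)).
- exact: (@continuous_comp _ _ _ fst _ x cvg_fst (@ptws_proj_continuous i _)).
- exact: (@continuous_comp _ _ _ snd _ x cvg_snd (@ptws_proj_continuous i _)).
Qed.

Let invP_continuous : continuous (fun x : P => x^-1%g).
Proof.
apply: ptws_continuous => i x.
by apply: continuous_comp; [exact: ptws_proj_continuous|exact: invg_continuous].
Qed.

HB.instance Definition _ := PreTopologicalGroup_isTopologicalGroup.Build P
  mulP_continuous invP_continuous.

End Product.

Definition cplx (R : realType) : numFieldType := R[i].

Record circle (R : realType) :=
  Circle { circle_val : cplx R ; circle_valP : `|circle_val| == 1 }.

HB.instance Definition _ (R : realType) := [isSub for @circle_val R].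
HB.instance Definition _ (R : realType) := [Choice of circle R by <:].
HB.instance Definition _ (R : realType) :=
  Topological.copy (circle R) (initial_topology (@circle_val R)).

Section Circle.
Variable R : realType.
Local Notation U1 := (circle R).

Let one_subproof : `|1 : cplx R| == 1. Proof. by rewrite normr1. Qed.
Let inv_subproof (z : U1) : `|(circle_val z)^-1| == 1.
Proof. by rewrite normfV (eqP (circle_valP z)) invr1. Qed.
Let mul_subproof (z w : U1) : `|circle_val z * circle_val w| == 1.
Proof.
by rewrite normrM (eqP (circle_valP z)) (eqP (circle_valP w)) mulr1.
Qed.

Let one : U1 := Circle one_subproof.
Let inv (z : U1) : U1 := Circle (inv_subproof z).
Let mul (z w : U1) : U1 := Circle (mul_subproof z w).

Let circle_neq0 (z : U1) : circle_val z != 0.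
Proof. by rewrite -normr_eq0 (eqP (circle_valP z)) oner_eq0. Qed.

Let mulA : associative mul.
Proof. by move=> x y z; apply/val_inj; exact: mulrA. Qed.
Let mul1 : left_id one mul.
Proof. by move=> x; apply/val_inj; exact: mul1r. Qed.
Let mulx1 : right_id one mul.
Proof. by move=> x; apply/val_inj; exact: mulr1. Qed.
Let mulVx : left_inverse one inv mul.
Proof. by move=> x; apply/val_inj; exact: mulVf. Qed.
Let mulxV : right_inverse one inv mul.
Proof. by move=> x; apply/val_inj; exact: mulfV. Qed.

HB.instance Definition _ := isGroup.Build U1 mulA mul1 mulx1 mulVx mulxV.

Lemma circle_val_continuous : continuous (@circle_val R).
Proof. exact: initial_continuous. Qed.

Lemma circle_continuous (X : topologicalType) (h : X -> U1) :
  continuous (fun x => circle_val (h x)) -> continuous h.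
Proof.
move=> /continuousP ch; apply/continuousP => _ [B oB <-].
exact: (ch B oB).
Qed.

Let mul_continuousU1 : continuous (fun x : U1 * U1 => (x.1 * x.2)%g).
Proof.
apply: circle_continuous => x.
apply: (@continuous2_cvg _ (cplx R) (cplx R) (cplx R) _ _
   (fun x : U1 * U1 => circle_val x.1) (fun x : U1 * U1 => circle_val x.2)
   (fun z w : cplx R => z * w)).
- exact: (@mul_continuous (cplx R) (circle_val x.1, circle_val x.2)).
- exact: (@continuous_comp _ _ _ fst _ x cvg_fst (@circle_val_continuous _)).
- exact: (@continuous_comp _ _ _ snd _ x cvg_snd (@circle_val_continuous _)).
Qed.

Let inv_continuousU1 : continuous (fun x : U1 => x^-1%g).
Proof.
apply: circle_continuous => x.
apply: (@continuous_comp _ _ _ (@circle_val R) (@GRing.inv (cplx R))).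
  exact: circle_val_continuous.
exact/inv_continuous/circle_neq0.
Qed.

HB.instance Definition _ := PreTopologicalGroup_isTopologicalGroup.Build U1
  mul_continuousU1 inv_continuousU1.

End Circle.

(* C^oo on an open set U: every iterated directional derivative is
   (Frechet) differentiable at every point of U. *)
Definition smooth_on (R : realType) (V V' : normedModType R) (U : set V)
    (f : V -> V') : Prop :=
  forall (vs : seq V) (x : V), U x ->
    differentiable (foldr (fun v g => 'D_v g) f vs) x.

Section LieGroups.
Variable R : realType.

Record chart (X : Type) (d : nat) := Chart {
  chart_dom : set X ;
  chart_coord : X -> 'rV[R]_d ;
  chart_inv : 'rV[R]_d -> X }.

Definition chart_cod (X : Type) d (c : chart X d) : set 'rV[R]_d :=
  chart_coord c @` chart_dom c.

Definition is_chart (X : topologicalType) d (c : chart X d) : Prop :=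
  [/\ open (chart_dom c), open (chart_cod c),
      {in chart_dom c, cancel (chart_coord c) (chart_inv c)},
      {within chart_dom c, continuous (chart_coord c)}
    & {within chart_cod c, continuous (chart_inv c)} ].

Definition smooth_atlas (X : topologicalType) d (A : set (chart X d)) : Prop :=
  [/\ forall c, A c -> is_chart c,
      forall x, exists2 c, A c & chart_dom c x
    & forall a b, A a -> A b ->
        smooth_on (chart_coord a @` (chart_dom a `&` chart_dom b))
          (chart_coord b \o chart_inv a)].

Definition smooth_group_laws (G : topologicalGroupType) d
    (A : set (chart G d)) : Prop :=
  (forall a b c, A a -> A b -> A c ->
     smooth_on
       [set u : 'rV[R]_d * 'rV[R]_d | [/\ chart_cod a u.1, chart_cod b u.2
          & chart_dom c (chart_inv a u.1 * chart_inv b u.2)%g]]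
       (fun u => chart_coord c (chart_inv a u.1 * chart_inv b u.2)%g)) /\
  (forall a c, A a -> A c ->
     smooth_on
       [set u | chart_cod a u /\ chart_dom c (chart_inv a u)^-1%g]
       (fun u => chart_coord c (chart_inv a u)^-1%g)).

(* Second countability is not required separately: it follows from
   compactness. *)
Definition compact_lie_group (G : topologicalGroupType) : Prop :=
  [/\ hausdorff_space G, compact [set: G]
    & exists d (A : set (chart G d)), smooth_atlas A /\ smooth_group_laws A].

(* Continuous isomorphisms suffice: a continuous isomorphism of Lie groups is
   automatically a diffeomorphism. *)
Definition torus (T : topologicalGroupType) : Prop :=
  exists (r : nat) (f : T -> {ptws 'I_r -> circle R}) (g : _ -> T),
    [/\ {morph f : x y / (x * y)%g}, cancel f g, cancel g f,
        continuous f & continuous g].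

End LieGroups.

Definition subgroup (G : groupType) (H : set G) : Prop :=
  [/\ H 1%g, forall x y, H x -> H y -> H (x * y)%g
    & forall x, H x -> H x^-1%g].

Definition closed_subgroup (G : topologicalGroupType) (H : set G) : Prop :=
  subgroup H /\ closed H.

Definition torsion (T : groupType) (n : nat) : set T :=
  [set t | t ^+ n = 1]%g.

Arguments torsion T n : clear implicits.

Definition conj_class (G : groupType) (H : set G) : set (set G) :=
  [set [set h ^ g | h in H]%g | g in [set: G]].

(* 1 -> T -> G -> W -> 1, with T embedded by iota (T has the topology of a
   subspace of G) and with the discrete topology on W *)
Record torus_extension (R : realType) (T G : topologicalGroupType)
    (W : finGroupType) (iota : T -> G) (proj : G -> W) : Prop := {
  ext_lie : compact_lie_group R G ;
  ext_torus : torus R T ;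
  ext_iotaM : {morph iota : x y / (x * y)%g} ;
  ext_iota_inj : injective iota ;
  ext_iota_embedding : forall U : set T,
    open U <-> exists2 V : set G, open V & iota @^-1` V = U ;
  ext_projM : {morph proj : x y / (x * y)%g} ;
  ext_proj_surj : forall w, exists g, proj g = w ;
  ext_proj_continuous : forall w, open (proj @^-1` [set w]) ;
  ext_exact : range iota = proj @^-1` [set 1%g] ;
  ext_component : range iota = connected_component [set: G] 1%g }.

Section FullSubgroups.
Variables (R : realType) (T G : topologicalGroupType) (W : finGroupType).
Variables (iota : T -> G) (proj : G -> W).

(* w . t = g t g^-1 for any g above w; see wactE *)
Definition wact (w : W) (t : T) : T :=
  xget 1%g [set t' | exists2 g, proj g = w & iota t' = (g * iota t * g^-1)%g].

Definition WSub : set (set T) :=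
  [set S | closed_subgroup S /\ forall w t, S t -> S (wact w t)].

(* T^*, as a set of functions; its group law is that of {ptws T -> U(1)} *)
Definition characters : set {ptws T -> circle R} :=
  [set chi | continuous (chi : T -> circle R) /\
             {morph (chi : T -> circle R) : s t / (s * t)%g}].

Definition wact_char (w : W) (chi : {ptws T -> circle R}) :
  {ptws T -> circle R} := fun t => chi (wact w^-1%g t).

Definition WSub_char : set (set {ptws T -> circle R}) :=
  [set L | [/\ L `<=` characters, subgroup L
             & forall w chi, L chi -> L (wact_char w chi)]].

Definition dagger (S : set T) : set {ptws T -> circle R} :=
  [set chi | characters chi /\ forall t, S t -> chi t = 1%g].

Definition full_subgroup : set (set G) :=
  [set H | closed_subgroup H /\ proj @` H = [set: W]].

(* Sub(G|full)/G *)
Definition full_classes : set (set (set G)) := @conj_class G @` full_subgroup.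

(* H `&` T, as a subset of T *)
Definition trace (H : set G) : set T := iota @^-1` H.

(* (H) |-> (H `&` T)^dagger, computed on a chosen representative of the class;
   see dual_traceE *)
Definition dual_trace (C : set (set G)) : set {ptws T -> circle R} :=
  dagger (trace (xget set0 C)).

End FullSubgroups.
Arguments dagger R {T} S.
Arguments characters R T : clear implicits.
Arguments WSub_char R {T G W} iota proj.
Arguments dual_trace R {T G} iota C.

Section WellDefined.
Variables (R : realType) (T G : topologicalGroupType) (W : finGroupType).
Variables (iota : T -> G) (proj : G -> W).
Hypothesis E : torus_extension R iota proj.
Local Open Scope group_scope.

Let iotaM : {morph iota : x y / x * y} := ext_iotaM E.
Let projM : {morph proj : x y / x * y} := ext_projM E.

Let iota1 : iota 1 = 1.
Proof. by apply: (mulgI (iota 1)); rewrite -iotaM !mulg1. Qed.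
Let proj1 : proj 1 = 1.
Proof. by apply: (mulgI (proj 1)); rewrite -projM !mulg1. Qed.
Let iotaV x : iota x^-1 = (iota x)^-1.
Proof. by apply: (mulgI (iota x)); rewrite -iotaM !mulgV iota1. Qed.
Let projV x : proj x^-1 = (proj x)^-1.
Proof. by apply: (mulgI (proj x)); rewrite -projM !mulgV proj1. Qed.

Let proj_iota t : proj (iota t) = 1.
Proof.
by have : range iota (iota t) by []; rewrite (ext_exact E).
Qed.

Lemma torus_mulgC (s t : T) : s * t = t * s.
Proof.
have [r [f [g [fM fK gK _ _]]]] := ext_torus E.
apply: (can_inj fK); rewrite !fM; apply/funext => i.
by apply/val_inj; exact: mulrC.
Qed.

Lemma wactE g t : iota (wact iota proj (proj g) t) = g * iota t * g^-1.
Proof.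
have : range iota (g * iota t * g^-1).
  by rewrite (ext_exact E) /= !projM projV proj_iota mulg1 mulgV.
move=> [t' _ t'E]; rewrite /wact; case: xgetP => [u _ /= [h hg ->]|].
  have [s _ sE] : range iota (g^-1 * h).
    by rewrite (ext_exact E) /= projM projV hg mulVg.
  have -> : h = g * iota s by rewrite sE mulVKg.
  rewrite invgM !mulgA -(mulgA g) -iotaM torus_mulgC iotaM.
  by rewrite mulgA mulgK.
by move=> /(_ t') /= []; exists g.
Qed.

Lemma wactM v w t :
  wact iota proj (v * w) t = wact iota proj v (wact iota proj w t).
Proof.
have [g <-] := ext_proj_surj E v; have [h <-] := ext_proj_surj E w.
by apply: (ext_iota_inj E); rewrite -projM !wactE invgM !mulgA.
Qed.

Lemma wact1 t : wact iota proj 1 t = t.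
Proof.
by apply: (ext_iota_inj E); rewrite -proj1 wactE mul1g invg1 mulg1.
Qed.

Lemma iota_continuous : continuous iota.
Proof.
by apply/continuousP => V oV; apply/(ext_iota_embedding E); exists V.
Qed.

Lemma wact_continuous w : continuous (wact iota proj w).
Proof.
have [g <-] := ext_proj_surj E w.
apply/continuousP => U /(ext_iota_embedding E)[V oV <-].
have -> : wact iota proj (proj g) @^-1` (iota @^-1` V) =
    (fun t => g * iota t * g^-1) @^-1` V.
  by apply/seteqP; split=> t /=; rewrite wactE.
move: V oV; apply/continuousP => t.
apply: (@continuous2_cvg _ _ _ _ _ _ (fun t => g * iota t) (fun=> g^-1)).
- exact: (mulg_continuous (g * iota t, g^-1)).
- apply: (@continuous2_cvg _ _ _ _ _ _ (fun=> g) iota).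
  + exact: (mulg_continuous (g, iota t)).
  + exact: cvg_cst.
  + exact: iota_continuous.
- exact: cvg_cst.
Qed.

Lemma wact_morph w :
  {morph wact iota proj w : s t / s * t}.
Proof.
have [g <-] := ext_proj_surj E w => s t; apply: (ext_iota_inj E).
by rewrite iotaM !wactE iotaM !mulgA mulgVK.
Qed.

Lemma trace_WSub H : full_subgroup proj H -> WSub iota proj (trace iota H).
Proof.
move=> [[[H1 HM HV] clH] fullH]; split; first split; first split.
- by rewrite /trace /= iota1.
- by move=> x y; rewrite /trace /= iotaM; exact: HM.
- by move=> x; rewrite /trace /= iotaV; exact: HV.
- by apply: closed_comp clH => x _; exact: iota_continuous.
- move=> w t Ht; have [h Hh <-] : (proj @` H) w by rewrite fullH.
  by rewrite /trace /= wactE; apply: (HM); [exact: HM|exact: HV].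
Qed.

Lemma trace_conj H H' : full_subgroup proj H -> conj_class H H' ->
  trace iota H' = trace iota H.
Proof.
move=> Hfull [g _ <-]; have [_ Wtr] := trace_WSub Hfull.
apply/seteqP; split=> t.
  move=> /= [h Hh hE]; rewrite -(wact1 t) -(mulVg (proj g)) wactM.
  by apply: Wtr; rewrite /trace /= wactE -hE conjgE !mulgA mulgV mul1g mulgK.
move=> Ht; exists (g * iota t * g^-1).
  by rewrite -wactE; exact: Wtr.
by rewrite conjgE !mulgA mulVg mul1g mulgVK.
Qed.

Lemma dual_traceE H : full_subgroup proj H ->
  dual_trace R iota (conj_class H) = dagger R (trace iota H).
Proof.
move=> Hfull; rewrite /dual_trace.
case: xgetP => [H' _ /(trace_conj Hfull)->//|].
move=> /(_ H) []; exists 1 => //; apply/seteqP; split=> x /=.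
  by move=> [h Hh <-]; rewrite conjg1.
by move=> Hx; exists x => //; rewrite conjg1.
Qed.

Lemma dagger_WSub_char S : WSub iota proj S ->
  WSub_char R iota proj (dagger R S).
Proof.
move=> [_ WS]; split; first by move=> chi [].
- split.
  + split=> //; split; first by move=> t; exact: cvg_cst.
    by move=> s t /=; rewrite mulg1.
  + move=> chi psi [[cchi mchi] chiS] [[cpsi mpsi] psiS]; split; first split.
    * move=> t; apply: (@continuous2_cvg _ _ _ _ _ _
        (chi : T -> circle R) (psi : T -> circle R)).
      - exact: (mulg_continuous (chi t, psi t)).
      - exact: cchi.
      - exact: cpsi.
    * move=> s t; apply/val_inj => /=; rewrite -/(chi _) -/(psi _).
      by rewrite mchi mpsi /=; exact: mulrACA.
    * by move=> t St; apply: etrans (mulg1 1); congr (_ * _); auto.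
  + move=> chi [[cchi mchi] chiS]; split; first split.
    * move=> t; exact: (@continuous_comp _ _ _ (chi : T -> circle R)
        (fun z : circle R => z^-1) t (cchi t) (@invg_continuous _ _)).
    * move=> s t; apply/val_inj; rewrite /= -/(chi _) mchi /=.
      exact: invfM.
    * by move=> t St; apply: etrans (@invg1 (circle R)); congr (_^-1); auto.
- move=> w chi [[cchi mchi] chiS]; split; first split.
  + move=> t; apply: continuous_comp; first exact: wact_continuous.
    exact: cchi.
  + by move=> s t; rewrite /wact_char wact_morph mchi.
  + by move=> t St; apply: chiS; exact: WS.
Qed.

End WellDefined.

(* Main.v *)
Require Import Defs.
From HB Require Import structures.
From mathcomp Require Import all_boot all_order all_algebra.
From mathcomp Require Import fingroup monoid complex.
From mathcomp Require Import all_classical all_reals all_analysis.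
From mathcomp Require Import ring lra.
Set Implicit Arguments.
Unset Strict Implicit.
Unset Printing Implicit Defensive.
Import Order.TTheory GRing.Theory Num.Theory.
Import numFieldNormedType.Exports.
Local Open Scope classical_set_scope.
Local Open Scope ring_scope.

(** Let m be the order of W. Both halves rest on the fact that m kills the
cohomology of W, in the concrete form that a cocycle multiplied over W bounds
its own m-th power ([average_cocycle1], [average_cocycle2]), together with the
divisibility of the torus ([torus_root]), which lets one extract m-th roots of
the bounding cochain.

For (1), n = m works. The 2-cocycle of a set-theoretic section of G -> W can
be corrected by a cochain so that its values lie in the m-torsion of the torus
([section_torsion_cocycle]). If S is W-invariant and contains this m-torsion,
the union of the cosets of S through the corrected section is a full subgroup
that meets the torus in S ([full_subgroup_of_section]).

For (2), the first point is that the trace S of a full subgroup on the torus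
can be recovered from the group L of characters trivial on it, because every
closed subgroup of the torus is the common kernel of r characters, where r is
the rank of the torus ([torus_subgroup_kernels]). This is proved for U(1)^r by
removing one coordinate at a time, together with the extension of characters
from closed subgroups; it comes down to the closed subgroups of U(1), which
are U(1) and the groups of n-th roots of unity, because the closed subgroups
of the line are the line and the lattices c Z.

Now fix a full subgroup H0 with trace S and a lift of every w in W to H0. Any
other full subgroup H with trace S is obtained by multiplying these lifts by
torus elements a(w), which form a 1-cocycle modulo S. Conjugating H by an m-th
root of the product of the a(w) makes every a(w)^m lie in S
([conj_class_torsion]). The r characters that cut out S then take values in
the m-th roots of unity at each a(w), and these values determine a(w) modulo
S, hence the conjugate of H ([full_subgroup_sub]). So every fibre has at most
m^(r m) elements, a bound that involves neither S nor L. *)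

(** * Closed subgroups of the real line *)

Section RealSubgroup.
Variables (R : realType) (A : set R).
Hypotheses (clA : closed A) (A0 : A 0).
Hypothesis AB : forall x y, A x -> A y -> A (x - y).

Lemma real_subgroupZ x (k : int) : A x -> A (x * k%:~R).
Proof.
have AN y : A y -> A (- y) by rewrite -sub0r; exact: AB.
have AD y z : A y -> A z -> A (y + z).
  by rewrite -{2}(opprK z) => ? /AN; exact: AB.
move=> Ax; have An n : A (x * n%:R).
  by elim: n => [|n IH]; rewrite ?mulr0// -natr1 mulrDr mulr1; exact: AD.
case: k => n; first exact: An.
by rewrite NegzE mulrNz mulrN; apply: AN; exact: An.
Qed.

(** Either the positive elements have a minimum c, and division with remainder
by c leaves a remainder below c, hence zero; or there are arbitrarily small
positive elements, whose multiples are dense. *)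
Lemma real_closed_subgroup :
  A = setT \/ exists2 c : R, 0 <= c & A = [set c * k%:~R | k in [set: int]].
Proof.
have floorA (c x : R) : 0 < c -> A c -> A x ->
    A (x - c * (Num.floor (x / c))%:~R).
  by move=> c0 Ac Ax; apply: AB => //; exact: real_subgroupZ.
have floor_ge (c x : R) : 0 < c -> 0 <= x - c * (Num.floor (x / c))%:~R.
  by move=> c0; rewrite subr_ge0 (mulrC c) -ler_pdivlMr// floor_le.
have floor_lt (c x : R) : 0 < c -> x - c * (Num.floor (x / c))%:~R < c.
  move=> c0; rewrite ltrBlDr -{1}(mulr1 c) -mulrDr (mulrC c) -ltr_pdivrMr//.
  by rewrite addrC; have := floorD1_gt (x / c); rewrite intrD.
have [[c [c0 Ac minc]]|nomin] :=
    pselect (exists c : R, [/\ 0 < c, A c & forall x, A x -> 0 < x -> c <= x]).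
  right; exists c; first exact: ltW.
  apply/seteqP; split=> [x Ax|_ [k _ <-]]; last exact: real_subgroupZ.
  exists (Num.floor (x / c)) => //.
  have := floor_ge c x c0; rewrite le_eqVlt => /orP[/eqP/esym/subr0_eq/esym//|].
  move/(minc _ (floorA c x c0 Ac Ax)); rewrite leNgt.
  by rewrite floor_lt.
have [[x [Ax x0]]|npos] := pselect (exists x, A x /\ 0 < x); last first.
  right; exists 0 => //; apply/seteqP; split=> [y Ay|_ [k _ <-]].
    2: by rewrite mul0r.
  exists 0 => //; rewrite mul0r.
  have [y0|y0|//] := ltgtP 0 y; first by case: npos; exists y.
  case: npos; exists (0 - y); rewrite sub0r oppr_gt0 -sub0r.
  by split=> //; exact: AB.
have small (e : R) : 0 < e -> exists y, [/\ A y, 0 < y & y < e].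
  move=> e0; apply: contrapT => nosmall.
  (* Without elements in ]0, e[, two positive elements closer than e are
     equal, so an element within e of the infimum is a minimum. *)
  pose P : set R := [set y | A y /\ 0 < y].
  have iP : has_inf P by split; [exists x|exists 0 => y [_ /ltW]].
  have [y [Ay y0] yi] := inf_adherent e0 iP.
  apply: nomin; exists y; split=> // z Az z0; rewrite leNgt; apply/negP => zy.
  apply: nosmall; exists (y - z); split; [exact: AB|by rewrite subr_gt0|].
  have zi : inf P <= z by apply: ge_inf => //; exact: iP.2.
  by lra.
left; apply/seteqP; split=> // y _; apply: clA.
move=> B /nbhs_ballP[e /= e0 eB]; have [c [Ac c0 ce]] := small e e0.
exists (c * (Num.floor (y / c))%:~R); split; first exact: real_subgroupZ.
apply: eB; rewrite /ball /= ger0_norm ?floor_ge//.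
exact: lt_trans (floor_lt _ _ c0) ce.
Qed.
End RealSubgroup.

(** * The exponential parametrization of the circle *)

Section Expi.
Variable R : realType.
Implicit Types x y : R.

Let expi_subproof x : `|(cos x +i* sin x)%C : cplx R| == 1.
Proof. by apply/eqP; rewrite (normc_def (_ +i* _)%C) /= cos2Dsin2 sqrtr1. Qed.

Definition expi x : circle R := Circle (expi_subproof x).

Lemma expiD x y : expi (x + y) = (expi x * expi y)%g.
Proof.
apply/val_inj; rewrite /= cosD sinD; apply/eqP; rewrite eq_complex /=.
by rewrite eqxx /=; apply/eqP; ring.
Qed.

Lemma expi_surj z : exists x, expi x = z.
Proof.
case: z => -[a b] z1; have := z1; rewrite (normc_def (a +i* b)%C) /= => /eqP[].
move/(congr1 (fun x => x ^+ 2)).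
rewrite expr1n sqr_sqrtr ?addr_ge0 ?sqr_ge0// => ab.
have a1 : -1 <= a <= 1.
  rewrite -ler_norml -(@expr_le1 _ 2)// real_normK ?num_real//.
  by rewrite -ab lerDl sqr_ge0.
have sa : sin (acos a) = `|b|.
  by rewrite sin_acos// -ab addrAC subrr add0r sqrtr_sqr.
have [b0|b0] := leP 0 b.
  exists (acos a); apply/val_inj; rewrite /= acosK ?in_itv//=.
  by rewrite sa ger0_norm.
exists (- acos a); apply/val_inj; rewrite /= cosN sinN acosK ?in_itv//=.
by rewrite sa ltr0_norm// opprK.
Qed.

Lemma expi_continuous : continuous expi.
Proof.
apply: circle_continuous => x; apply/(@cvgrPdist_lt (cplx R) (cplx R)) => -[e e'].
rewrite ltcE /= => /andP[/eqP->{e'} e0].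
have e2 : 0 < e / 2 by rewrite divr_gt0.
have /cvgrPdist_lt/(_ _ e2) cc := @continuous_cos R x.
have /cvgrPdist_lt/(_ _ e2) cs := @continuous_sin R x.
near=> y.
have -> : ((cos x +i* sin x) - (cos y +i* sin y))%C =
   ((cos x - cos y)%:C + 'i * (sin x - sin y)%:C)%C :> cplx R.
  by apply/eqP; rewrite eq_complex /= !mul0r !mul1r !subr0 !add0r !addr0 !eqxx.
apply: le_lt_trans (ler_normD _ _) _; rewrite normrM.
have nC (a : R) : `|a%:C%C : cplx R| = (`|a|)%:C%C.
  by rewrite (normc_def a%:C%C) /= expr0n addr0 sqrtr_sqr.
have -> : `|'i%C : cplx R| = 1.
  by rewrite (normc_def 'i%C) /= expr0n expr1n add0r sqrtr1.
rewrite mul1r !nC -rmorphD ltcE /= eqxx /= [e]splitr.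
by apply: ltrD; near: y.
Unshelve. all: by end_near.
Qed.

Lemma expi0 : expi 0 = 1%g.
Proof. by apply/val_inj; rewrite /= cos0 sin0. Qed.

Lemma expiN x : expi (- x) = (expi x)^-1%g.
Proof.
by apply: (@mulgI _ (expi x)); rewrite -expiD subrr expi0 mulgV.
Qed.

Lemma expiMn x n : expi (x * n%:R) = (expi x ^+ n)%g.
Proof.
elim: n => [|n IH]; first by rewrite mulr0 expi0.
by rewrite -natr1 mulrDr mulr1 expiD IH expgSr.
Qed.

Lemma preimage_expi_closed_subgroup (A : set (circle R)) :
  closed_subgroup A ->
  A = setT \/
  exists2 c, 0 <= c & expi @^-1` A = [set c * k%:~R | k in [set: int]].
Proof.
move=> [[A1 AM AV] clA].
have [||||H] := @real_closed_subgroup R (expi @^-1` A); last by right.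
- by apply: preimage_closed clA => x _; exact: expi_continuous.
- by rewrite /= expi0.
- by move=> x y; rewrite /= expiD expiN => ? ?; apply: AM => //; exact: AV.
- move=> AT; left; apply/seteqP; split=> // z _.
  by have [x <-] := expi_surj z; have : [set: R] x by []; rewrite -AT.
Qed.

Lemma circle_hausdorff : hausdorff_space (circle R).
Proof.
move=> x y xy; apply/val_inj/(@norm_hausdorff (cplx R) (cplx R)) => A B nA nB.
have [z [Az Bz]] := xy _ _ (circle_val_continuous nA) (circle_val_continuous nB).
by exists (circle_val z).
Qed.

Lemma circle_set1_closed (z : circle R) : closed [set z].
Proof. exact/accessible_closed_set1/hausdorff_accessible/circle_hausdorff. Qed.

(** The kernel is a closed subgroup of the line that contains 2 pi and misses
pi, so it is a lattice of positive period. *)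
Lemma ker_expi : exists2 p : R, 0 < p &
  forall x, expi x = 1%g <-> exists k : int, x = p * k%:~R.
Proof.
have [|E|[c c0 E]] := @preimage_expi_closed_subgroup [set 1%g].
- split; last exact: circle_set1_closed.
  by split=> // [x y -> ->|x ->]; rewrite ?mulg1 ?invg1.
- have : [set: circle R] (expi pi) by [].
  rewrite -E => /(congr1 (@circle_val R))[]; rewrite cospi => /eqP.
  by rewrite eq_sym -subr_eq0 opprK (_ : 1 + 1 = 2%:R)// pnatr_eq0.
have kerE x : expi x = 1%g <-> exists k : int, x = c * k%:~R.
  have -> : (expi x = 1%g) = (expi @^-1` [set 1%g]) x by [].
  by rewrite E; split=> [[k _ <-]|[k ->]]; exists k.
exists c => //; rewrite lt_neqAle c0 andbT; apply/negP => /eqP c00.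
have /kerE[k] : expi (pi + pi) = 1%g.
  rewrite expiD; apply/val_inj; rewrite /= cospi sinpi.
  by apply/eqP; rewrite eq_complex /= mulrNN !mulr1 !mulr0 !mul0r
    subr0 addr0 !eqxx.
by rewrite -c00 mul0r => /eqP; rewrite gt_eqF// addr_gt0// pi_gt0.
Qed.

Lemma circle_root n (z : circle R) :
  (0 < n)%N -> exists w : circle R, (w ^+ n)%g = z.
Proof.
move=> n0; have [x <-] := expi_surj z; exists (expi (x / n%:R)).
by rewrite -expiMn divfK// pnatr_eq0 -lt0n.
Qed.

Lemma circle_roots_of_unity n : (0 < n)%N ->
  exists2 zeta : circle R, (zeta ^+ n)%g = 1%g &
    forall z, (z ^+ n)%g = 1%g -> exists j : 'I_n, z = (zeta ^+ j)%g.
Proof.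
move=> n0; have [p p0 kerE] := ker_expi.
have n0' : n%:R != 0 :> R by rewrite pnatr_eq0 -lt0n.
exists (expi (p / n%:R)).
  by rewrite -expiMn divfK//; apply/kerE; exists 1; rewrite mulr1.
move=> z; have [x <-{z}] := expi_surj z; rewrite -expiMn => /kerE[k xE].
have jn : ((k %% n%:Z)%Z < n%:Z) by exact: ltz_pmod.
have [j jE] : exists j : nat, (k %% n%:Z)%Z = j :> int.
  by exists `|(k %% n%:Z)%Z|%N; rewrite gez0_abs// modz_ge0// -lt0n.
move: jn; rewrite jE ltz_nat => jn; exists (Ordinal jn).
have -> : x = p * (k %/ n%:Z)%Z%:~R + p / n%:R * j%:R.
  apply: (mulIf n0'); rewrite xE {1}(divz_eq k n%:Z) jE intrD intrM.
  rewrite -!pmulrn; field.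
  exact: n0'.
rewrite expiD -expiMn (_ : expi (p * _) = 1%g) ?mul1g//.
by apply/kerE; exists (k %/ n%:Z)%Z.
Qed.

(** The preimage of A on the line is a lattice c Z. It contains the period p of
[expi], so p = c n, and then A is the group of n-th roots of unity. *)
Lemma circle_closed_subgroup (A : set (circle R)) : closed_subgroup A ->
  A = setT \/ exists2 n, (0 < n)%N & A = [set z | (z ^+ n)%g = 1%g].
Proof.
move=> sA; have [p p0 kerE] := ker_expi.
have [|[c c0 AE]] := preimage_expi_closed_subgroup sA; [by left|right].
have AcE x : A (expi x) = [set c * k%:~R | k in [set: int]] x by rewrite -AE.
have : A (expi p).
  by rewrite (kerE p).2; [case: sA.1|exists 1; rewrite mulr1].
rewrite AcE => -[k _ pE].
have cp : 0 < c.
  rewrite lt_neqAle c0 andbT; apply: contraTneq p0 => c00.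
  by rewrite -pE -c00 mul0r ltxx.
have k0 : (0 < k)%R by move: p0; rewrite -pE pmulr_rgt0// ltr0z.
case: k k0 pE => // n n0 pE; exists n => //.
apply/seteqP; split=> z; have [x <-] := expi_surj z.
  rewrite AcE /= => -[k _ <-]; rewrite -expiMn; apply/kerE; exists k.
  by rewrite -pE mulrAC.
move=> /=; rewrite -expiMn => /kerE[k kE]; rewrite AcE; exists k => //.
have n0' : n%:R != 0 :> R by rewrite pnatr_eq0 -lt0n.
by apply: (mulIf n0'); rewrite kE -pE mulrAC.
Qed.

Lemma circle_compact : compact [set: circle R].
Proof.
have [p p0 kerE] := ker_expi.
suff -> : [set: circle R] = expi @` `[0, p].
  apply: continuous_compact; last exact: segment_compact.
  by apply: continuous_subspaceT; exact: expi_continuous.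
apply/seteqP; split=> // z _; have [x <-] := expi_surj z.
exists (x - p * (Num.floor (x / p))%:~R).
  rewrite /= in_itv /= subr_ge0 (mulrC p) -ler_pdivlMr// floor_le /=.
  rewrite lerBlDr -{1}(mul1r p) -mulrDl -ler_pdivrMr//.
  by rewrite addrC; have := floorD1_gt (x / p); rewrite intrD => /ltW.
rewrite expiD (_ : expi (- _) = 1%g) ?mulg1//.
by apply/kerE; exists (- Num.floor (x / p)); rewrite mulrNz mulrN.
Qed.

End Expi.

(** * Morphisms of topological groups and their descent *)

Lemma morph_mulg1 (X Y : groupType) (f : X -> Y) :
  {morph f : x y / (x * y)%g} -> f 1%g = 1%g.
Proof. by move=> fM; apply: (mulgI (f 1%g)); rewrite -fM !mulg1. Qed.

Lemma morph_mulgV (X Y : groupType) (f : X -> Y) :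
  {morph f : x y / (x * y)%g} -> {morph f : x / x^-1%g}.
Proof.
by move=> fM x; apply: (mulgI (f x)); rewrite -fM !mulgV (morph_mulg1 fM).
Qed.

Lemma morph_mulgX (X Y : groupType) (f : X -> Y) n :
  {morph f : x y / (x * y)%g} -> {morph f : x / (x ^+ n)%g}.
Proof.
move=> fM x; elim: n => [|n IH]; first by rewrite !expg0 (morph_mulg1 fM).
by rewrite !expgSr fM IH.
Qed.

Lemma morph_preimage_subgroup (X Y : groupType) (f : X -> Y) (A : set Y) :
  {morph f : x y / (x * y)%g} -> subgroup A -> subgroup (f @^-1` A).
Proof.
move=> fM [A1 AM AV]; split=> /= [|x y|x]; first by rewrite (morph_mulg1 fM).
  by rewrite fM; exact: AM.
by rewrite (morph_mulgV fM); exact: AV.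
Qed.

Lemma morph_preimage_closed_subgroup (X Y : topologicalGroupType) (f : X -> Y)
    (A : set Y) : continuous f ->
  {morph f : x y / (x * y)%g} -> closed_subgroup A ->
  closed_subgroup (f @^-1` A).
Proof.
move=> cf fM [sA clA]; split; first exact: morph_preimage_subgroup.
by apply: preimage_closed clA => x _; exact: cf.
Qed.

Lemma morph_image_subgroup (X Y : groupType) (f : X -> Y) (A : set X) :
  {morph f : x y / (x * y)%g} -> subgroup A -> subgroup (f @` A).
Proof.
move=> fM [A1 AM AV]; split.
- by exists 1%g => //; exact: morph_mulg1.
- by move=> _ _ [x Ax <-] [y Ay <-]; exists (x * y)%g => //; exact: AM.
- by move=> _ [x Ax <-]; exists x^-1%g; [exact: AV|exact: morph_mulgV].
Qed.

Lemma within_continuous_comp (X Y Z : topologicalType) (e : X -> Y)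
    (f : Y -> Z) (A : set Y) : continuous e ->
  {within A, continuous f} -> {within e @^-1` A, continuous (f \o e)}.
Proof.
move=> ce /subspace_continuousP cf; apply/subspace_continuousP => x Aex B nB.
exact: (ce x _ (cf (e x) Aex B nB)).
Qed.

Lemma within_continuousM (X : topologicalType) (G : topologicalGroupType)
    (A : set X) (f g : X -> G) : {within A, continuous f} ->
  {within A, continuous g} -> {within A, continuous (fun x => f x * g x)%g}.
Proof.
move=> cf cg x.
apply: (@continuous2_cvg _ _ _ _ _ _ (f : subspace A -> G) g).
- exact: (mulg_continuous (f x, g x)).
- exact: cf.
- exact: cg.
Qed.

(** On the compact set A the map q is closed, hence a topological quotient onto
its image. *)
Lemma within_continuous_descent (X Y Z : topologicalType) (q : X -> Y)
    (f : X -> Z) (g : Y -> Z) (A : set X) :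
  hausdorff_space Y -> compact A -> continuous q ->
  {within A, continuous f} -> (forall x, A x -> g (q x) = f x) ->
  {within q @` A, continuous g}.
Proof.
move=> hY kA cq cf gE; apply/continuous_closedP => B cB.
have /continuous_closedP/(_ B cB)/closed_subspaceP[V cV VA] := cf.
apply/closed_subspaceP; exists (q @` (A `&` V)).
  apply: compact_closed => //; apply: continuous_compact.
    exact: continuous_subspaceT.
  exact: compact_closedI.
have VE x : A x -> V x = B (f x).
  move=> Ax; apply/propext; split=> [Vx|Bx].
    by have : (V `&` A) x by []; rewrite VA => -[].
  by have : (f @^-1` B `&` A) x by []; rewrite -VA => -[].
apply/seteqP; split=> y [].
  move=> [x [Ax Vx] <-] _; split; last by exists x.
  by change (B (g (q x))); rewrite gE// -VE.
change (B (g y) -> (q @` A) y -> (q @` (A `&` V) `&` q @` A) y).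
move=> By [x Ax xy]; move: By; rewrite -xy gE// -VE// => Vx.
by split; exists x.
Qed.

(** * Characters of closed subgroups *)

Section CharactersOnSubgroups.
Variables (R : realType) (X : topologicalGroupType).
Implicit Types (S : set X) (phi : X -> circle R).

(** A character of the subgroup S is represented by a map on the whole group:
S keeps the subspace topology and no type of its elements is needed. *)
Definition char_on S phi : Prop :=
  {within S, continuous phi} /\
  forall s t, S s -> S t -> phi (s * t)%g = (phi s * phi t)%g.

Lemma char_on_characters S (chi : {ptws X -> circle R}) :
  characters R X chi -> char_on S chi.
Proof.
move=> [cchi mchi]; split; first exact: continuous_subspaceT.
by move=> s t _ _; exact: mchi.
Qed.

Lemma circle_mulgC : commutative (@mulg (circle R)).
Proof. by move=> x y; apply/val_inj; exact: mulrC. Qed.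

Lemma char_onM S phi psi : char_on S phi -> char_on S psi ->
  char_on S (fun x => phi x * psi x)%g.
Proof.
move=> [cphi mphi] [cpsi mpsi]; split; first exact: within_continuousM.
move=> s t Ss St; rewrite mphi// mpsi// !mulgA; congr (_ * _)%g.
by rewrite -!mulgA; congr (_ * _)%g; exact: circle_mulgC.
Qed.

Lemma char_onV S phi : char_on S phi -> char_on S (fun x => (phi x)^-1)%g.
Proof.
move=> [cphi mphi]; split.
  move=> x; apply: (@continuous_comp _ _ _ (phi : subspace S -> circle R)).
    exact: cphi.
  exact: invg_continuous.
by move=> s t Ss St; rewrite mphi// invgM circle_mulgC.
Qed.

Lemma characters1 : characters R X (fun=> 1%g).
Proof. by split=> [x|x y]; [exact: cst_continuous|rewrite mulg1]. Qed.

Lemma charactersM (chi psi : {ptws X -> circle R}) : characters R X chi ->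
  characters R X psi -> characters R X (fun x => chi x * psi x)%g.
Proof.
move=> /(@char_on_characters setT)/char_onM cM.
move=> /(@char_on_characters setT)/cM[/(continuous_subspace_setT _).2 c m].
by split=> // x y; exact: m x y I I.
Qed.

Lemma charactersV (chi : {ptws X -> circle R}) : characters R X chi ->
  characters R X (fun x => (chi x)^-1)%g.
Proof.
move=> /(@char_on_characters setT)/char_onV[/(continuous_subspace_setT _).2 c m].
by split=> // x y; exact: m x y I I.
Qed.

End CharactersOnSubgroups.

Lemma characters_comp (R : realType) (X Y : topologicalGroupType) (q : X -> Y)
    (chi : {ptws Y -> circle R}) : continuous q ->
  {morph q : x y / (x * y)%g} -> characters R Y chi ->
  characters R X (chi \o q).
Proof.
move=> cq qM [cchi mchi]; split; last by move=> x y /=; rewrite qM mchi.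
by move=> x; apply: continuous_comp; [exact: cq|exact: cchi].
Qed.

Lemma char_on_comp (R : realType) (X Y : topologicalGroupType) (e : X -> Y)
    (S : set Y) (phi : Y -> circle R) : continuous e ->
  {morph e : x y / (x * y)%g} -> char_on S phi ->
  char_on (e @^-1` S) (phi \o e).
Proof.
move=> ce eM [cphi mphi]; split; first exact: within_continuous_comp.
by move=> s t Ss St /=; rewrite eM mphi.
Qed.

Lemma char_on_descent (R : realType) (X Y : topologicalGroupType) (q : X -> Y)
    (S : set X) (phi : X -> circle R) :
  hausdorff_space Y -> compact S -> continuous q ->
  {morph q : x y / (x * y)%g} -> subgroup S -> char_on S phi ->
  (forall s, S s -> q s = 1%g -> phi s = 1%g) ->
  exists2 psi, char_on (q @` S) psi & forall s, S s -> psi (q s) = phi s.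
Proof.
move=> hY kS cq qM [S1 SM SV] [cphi mphi] ker_phi.
pose psi y := phi (xget 1%g [set s | S s /\ q s = y]).
have psiE s : S s -> psi (q s) = phi s.
  move=> Ss; rewrite /psi; case: xgetP => [s' _ /= [Ss' qs]|/(_ s)[]//].
  have -> : s' = (s' * s^-1 * s)%g by rewrite mulgVK.
  have Sd : S (s' * s^-1)%g by apply: SM => //; exact: SV.
  by rewrite mphi// ker_phi ?mul1g// qM (morph_mulgV qM) qs mulgV.
exists psi => //; split; first exact: (within_continuous_descent (f := phi)).
move=> _ _ [s Ss <-] [t St <-].
by rewrite -qM !psiE//; [exact: mphi|exact: SM].
Qed.

Section Circle.
Variable R : realType.

Lemma circle_expg_character n :
  characters R (circle R) (fun z : circle R => z ^+ n)%g.
Proof.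
elim: n => [|n IH].
  exact: characters1.
have idc : characters R (circle R) (fun z : circle R => z).
  by split=> // x; exact: cvg_id.
rewrite (_ : (fun z => _) = (fun z : circle R => z ^+ n * z)%g).
  exact: (charactersM IH idc).
by apply/funext => z; exact: expgSr.
Qed.

Lemma circle_subgroup_kernel (A : set (circle R)) : closed_subgroup A ->
  exists2 kappa, characters R (circle R) kappa & A = [set z | kappa z = 1%g].
Proof.
move=> /circle_closed_subgroup[->|[n n0 ->]].
  exists (fun z : circle R => z ^+ 0)%g; first exact: circle_expg_character.
  by apply/seteqP; split.
by exists (fun z : circle R => z ^+ n)%g => //; exact: circle_expg_character.
Qed.

(** A proper closed subgroup is generated by a primitive root of unity zeta of
some order n; the character sends zeta to an n-th root of unity, which is a
power zeta^j, so z -> z^j extends it. *)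
Lemma circle_char_extends (A : set (circle R)) (phi : circle R -> circle R) :
  closed_subgroup A -> char_on A phi ->
  exists2 chi, characters R (circle R) chi & forall z, A z -> chi z = phi z.
Proof.
move=> sA [cphi mphi]; have [AT|[n n0 AE]] := circle_closed_subgroup sA.
  exists phi => //; move: cphi mphi; rewrite AT.
  move=> /(continuous_subspace_setT _).2 cphi mphi; split=> // x y.
  exact: mphi x y I I.
have [zeta zeta1 genA] := circle_roots_of_unity R n0.
have Az : A zeta by rewrite AE.
have phiX j : phi (zeta ^+ j)%g = (phi zeta ^+ j)%g /\ A (zeta ^+ j)%g.
  have [[A1 AM AV] _] := sA.
  elim: j => [|j [IH Aj]]; last first.
    by rewrite !expgSr mphi// IH; split=> //; exact: AM.
  rewrite !expg0; split=> //; apply: (mulgI (phi 1%g)).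
  by rewrite -mphi// !mulg1.
have /genA[j jE] : (phi zeta ^+ n)%g = 1%g.
  rewrite -(phiX n).1 zeta1; have := (phiX 0).1; by rewrite !expg0.
exists (fun z : circle R => z ^+ j)%g; first exact: circle_expg_character.
move=> z; rewrite AE => /genA[i ->].
by rewrite (phiX i).1 jE expgnAC.
Qed.

End Circle.

(** * Duality for closed subgroups of a torus *)

Section StandardTorus.
Variables (R : realType) (r : nat).
Local Notation P := {ptws 'I_r -> circle R}.

Definition axis (k : 'I_r) (z : circle R) : P :=
  fun i => if i == k then z else 1%g.
Definition forget (k : 'I_r) (t : P) : P :=
  fun i => if i == k then 1%g else t i.
Definition subtorus (k : nat) : set P :=
  [set t | forall i : 'I_r, (k <= i)%N -> t i = 1%g].

Lemma axis_continuous k : continuous (axis k).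
Proof.
apply: ptws_continuous => i; rewrite /axis; case: eqP => _ x.
  exact: cvg_id.
exact: cst_continuous.
Qed.

Lemma axisM k : {morph axis k : x y / (x * y)%g}.
Proof.
move=> x y; apply/funext => i; rewrite /axis /mulg /=.
by case: eqP => _ //; rewrite mulg1.
Qed.

Lemma forget_continuous k : continuous (forget k).
Proof.
apply: ptws_continuous => i; rewrite /forget; case: eqP => _ x.
  exact: cst_continuous.
exact: ptws_proj_continuous.
Qed.

Lemma forgetM k : {morph forget k : x y / (x * y)%g}.
Proof.
move=> x y; apply/funext => i; rewrite /forget /mulg /=.
by case: eqP => _ //; rewrite mulg1.
Qed.

Lemma coord_character (k : 'I_r) : characters R P (fun t => t k).
Proof. by split=> //; exact: ptws_proj_continuous. Qed.

(** The torus is the internal direct product of its k-th axis and the subtorus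
where the k-th coordinate is trivial. Working with the endomorphism [forget]
of a fixed torus lets the inductions below lower the rank without changing the
ambient group. *)
Lemma forget_axis k t : (forget k t * axis k (t k))%g = t.
Proof.
apply/funext => i; rewrite /forget /axis /mulg /=.
by case: eqP => [->|_]; [rewrite mul1g|rewrite mulg1].
Qed.

Lemma std_torus_hausdorff : hausdorff_space P.
Proof.
apply: hausdorff_product => i; exact: circle_hausdorff.
Qed.

Lemma std_torus_compact : compact [set: P].
Proof.
have := @tychonoff 'I_r (fun=> circle R) (fun=> setT)
  (fun=> @circle_compact R).
by congr (compact _); apply/seteqP; split.
Qed.

Lemma std_torus_closed_compact (S : set P) : closed S -> compact S.
Proof. by move=> /subclosed_compact; apply; [exact: std_torus_compact|]. Qed.

Lemma forget_closed_subgroup k (S : set P) :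
  closed_subgroup S -> closed_subgroup (forget k @` S).
Proof.
move=> [sS clS]; split.
  exact: (morph_image_subgroup (@forgetM k)).
apply: (compact_closed std_torus_hausdorff); apply: continuous_compact.
  by apply: continuous_subspaceT; exact: forget_continuous.
exact: std_torus_closed_compact.
Qed.

Lemma forget_subtorus (k : 'I_r) (t : P) :
  subtorus k.+1 t -> subtorus k (forget k t).
Proof.
move=> tk i ki; rewrite /forget; case: eqVneq => // ik; apply: tk.
by rewrite ltn_neqAle ki andbT eq_sym.
Qed.

(** Induction on the number k of active coordinates. The restriction of phi to
the last axis extends to a character kappa of the circle. The quotient of phi
by kappa is trivial on the part of S inside that axis, so it descends to the
projection of S to the other coordinates, where the induction hypothesis
extends it. *)
Lemma std_torus_char_extends k : (k <= r)%N ->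
  forall (S : set P) (phi : P -> circle R),
  closed_subgroup S -> S `<=` subtorus k -> char_on S phi ->
  exists2 chi, characters R P chi & forall s, S s -> chi s = phi s.
Proof.
elim: k => [_|k IH kr] S phi sS Sk cphi.
  exists (fun=> 1%g); first exact: characters1.
  move=> s /Sk s1; have -> : s = 1%g by apply/funext => i; exact: s1.
  have S1 : S 1%g by case: sS => -[].
  by apply: (mulgI (phi 1%g)); rewrite -cphi.2// !mulg1.
pose kk := Ordinal kr; pose q := forget kk; pose e := axis kk.
have [kappa ckappa kappaE] := circle_char_extends
  (morph_preimage_closed_subgroup (@axis_continuous kk) (@axisM kk) sS)
  (char_on_comp (@axis_continuous kk) (@axisM kk) cphi).
have ck : characters R P (fun t => kappa (t kk)).
  by apply: characters_comp ckappa; have [] := coord_character kk.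
have [|s Ss qs1|psi cpsi psiE] := @char_on_descent R P P q S
    (fun s => phi s * (kappa (s kk))^-1)%g std_torus_hausdorff
    (std_torus_closed_compact sS.2) (@forget_continuous kk) (@forgetM kk) sS.1.
- by apply: char_onM => //; apply/char_onV/char_on_characters.
- have se : s = e (s kk) by rewrite -[LHS](forget_axis kk) -/(q s) qs1 mul1g.
  by rewrite kappaE /= -/e -se// mulgV.
have [chi cchi chiE] : exists2 chi, characters R P chi &
    forall s, (q @` S) s -> chi s = psi s.
  apply: IH => //; first exact: ltnW.
    exact: forget_closed_subgroup.
  by move=> _ [s Ss <-]; apply: (@forget_subtorus kk); exact: Sk.
exists (fun t => chi (q t) * kappa (t kk))%g.
  apply: charactersM => //; apply: characters_comp cchi.
    exact: forget_continuous.
  exact: forgetM.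
by move=> s Ss; rewrite chiE ?psiE ?mulgVK//; exists s.
Qed.

(** Induction on the number k of active coordinates, one character per
coordinate. The part of S in the last axis is the kernel of a character kappa.
On S, kappa of the last coordinate depends only on the other coordinates, and
this dependence extends to a character theta of the whole torus. An element t
whose projection lies in the projection of S then belongs to S if and only if
kappa of its last coordinate is theta of its projection. *)
Lemma std_torus_subgroup_kernels k : (k <= r)%N ->
  forall S : set P, closed_subgroup S -> S `<=` subtorus k ->
  exists2 chi : 'I_r -> {ptws P -> circle R}, forall j, characters R P (chi j) &
    S = [set t | subtorus k t /\ forall j : 'I_r, (j < k)%N -> chi j t = 1%g].
Proof.
elim: k => [_|k IH kr] S sS Sk.
  exists (fun _ _ => 1%g); first by move=> _; exact: characters1.
  apply/seteqP; split=> [s /Sk//|s [s1 _]].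
  have -> : s = 1%g by apply/funext => i; exact: s1.
  by case: sS => -[].
pose kk := Ordinal kr; pose q := forget kk; pose e := axis kk.
have [S1 SM SV] := sS.1.
have [kappa ckappa kappaE] := circle_subgroup_kernel
  (morph_preimage_closed_subgroup (@axis_continuous kk) (@axisM kk) sS).
have ck : characters R P (fun t => kappa (t kk)).
  by apply: characters_comp ckappa; have [] := coord_character kk.
have kerE z : S (e z) <-> kappa z = 1%g.
  by rewrite (_ : S (e z) = (axis kk @^-1` S) z)// kappaE.
have [|s Ss qs1|psi cpsi psiE] := @char_on_descent R P P q S
    (fun s => kappa (s kk)) std_torus_hausdorff
    (std_torus_closed_compact sS.2) (@forget_continuous kk) (@forgetM kk) sS.1.
- exact: char_on_characters.
- have se : s = e (s kk) by rewrite -[LHS](forget_axis kk) -/(q s) qs1 mul1g.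
  by apply/kerE; rewrite -se.
have sQ : closed_subgroup (q @` S) by exact: forget_closed_subgroup.
have Qk : q @` S `<=` subtorus k.
  by move=> _ [s Ss <-]; apply: (@forget_subtorus kk); exact: Sk.
have [theta ctheta thetaE] := std_torus_char_extends (ltnW kr) sQ Qk cpsi.
have [chi cchi QE] := IH (ltnW kr) _ sQ Qk.
have cq (xi : {ptws P -> circle R}) : characters R P xi ->
    characters R P (fun t => xi (q t)).
  by apply: characters_comp; [exact: forget_continuous|exact: forgetM].
exists (fun j => if j == kk
  then (fun t => kappa (t kk) * (theta (q t))^-1)%g
  else (fun t => chi j (q t))).
  move=> j; case: eqP => _; last exact: cq.
  by apply: charactersM => //; apply/charactersV/cq.
apply/seteqP; split=> [s Ss|t [tk tchi]].
  split; first exact: Sk.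
  have Qs : (q @` S) (q s) by exists s.
  move=> j; rewrite ltnS leq_eqVlt => /orP[/eqP jk|jk].
    by rewrite (_ : j = kk) ?eqxx ?thetaE ?psiE ?mulgV//; apply: val_inj.
  rewrite -val_eqE /= (ltn_eqF jk).
  by have := Qs; rewrite QE => -[_]; apply.
have [s Ss st] : (q @` S) (q t).
  rewrite QE; split; first exact: (@forget_subtorus kk).
  move=> j jk; have := tchi j (ltnW jk).
  by rewrite -val_eqE /= (ltn_eqF jk).
(* t and s have the same projection, so they differ by an element of the last
   axis, which lies in S as soon as kappa takes equal values on the last
   coordinates of t and s. *)
have /eqP := tchi kk (ltnSn k); rewrite eqxx -st thetaE ?psiE//.
rewrite -(inj_eq (@mulIg _ (kappa (s kk)))) mulgVK mul1g => /eqP kts.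
have -> : t = (s * e ((s kk)^-1 * t kk))%g.
  rewrite /e axisM mulgA -{1}(forget_axis kk t) -/q -st; congr (_ * _)%g.
  rewrite -{2}(forget_axis kk s) -mulgA -axisM mulgV.
  by rewrite (morph_mulg1 (@axisM kk)) mulg1.
apply: SM => //; apply/kerE.
by have [_ ->] := ckappa; rewrite kts (morph_mulgV ckappa.2) mulVg.
Qed.

End StandardTorus.

(** The number r of characters is the rank of T: it is the same for all closed
subgroups, which is what makes the final bound uniform. *)
Lemma torus_subgroup_kernels (R : realType) (T : topologicalGroupType) :
  torus R T -> exists r, forall S : set T, closed_subgroup S ->
  exists2 chi : 'I_r -> {ptws T -> circle R}, forall j, characters R T (chi j) &
    S = [set t | forall j, chi j t = 1%g].
Proof.
move=> [r [f [g [fM fK gK cf cg]]]]; exists r => S sS.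
have gM : {morph g : x y / (x * y)%g}.
  by move=> x y; apply: (can_inj fK); rewrite fM !gK.
have [|chi cchi SE] := @std_torus_subgroup_kernels R r r (leqnn r) (g @^-1` S)
  (morph_preimage_closed_subgroup cg gM sS).
  by move=> t _ i; rewrite leqNgt ltn_ord.
exists (fun j => chi j \o f); first by move=> j; exact: characters_comp.
have SE' t : S t = (g @^-1` S) (f t) by rewrite /= fK.
apply/seteqP; split=> t; rewrite SE' SE.
  by move=> [_ h] j; exact: h.
by move=> h; split=> [i|j _]; [rewrite leqNgt ltn_ord|exact: h].
Qed.

Lemma torus_root (R : realType) (T : topologicalGroupType) n (t : T) :
  torus R T -> (0 < n)%N -> exists s, (s ^+ n)%g = t.
Proof.
move=> [r [f [g [fM fK gK _ _]]]] n0.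
have rootP z : {w : circle R | (w ^+ n)%g = z} by exact/cid/circle_root.
pose h : {ptws 'I_r -> circle R} := fun i => sval (rootP (f t i)).
exists (g h); apply: (can_inj fK); rewrite (morph_mulgX _ fM) gK.
apply/funext => i.
rewrite (@morph_mulgX {ptws 'I_r -> circle R} _ (fun u => u i))//.
exact: (svalP (rootP (f t i))).
Qed.

(** * Averaging cocycles over a finite group *)

Section Averaging.
Variables (T : groupType) (W : finGroupType) (act : W -> T -> T).
Hypotheses (mulTC : commutative (@mulg T))
  (actM : forall w, {morph act w : s t / (s * t)%g}).
Local Open Scope group_scope.

(* The commutativity of T is registered with its multiplication so that
   products over W can be split and reindexed. *)
HB.instance Definition _ := SemiGroup.isCommutativeLaw.Build T mulg mulTC.

Let act_prod w (F : W -> T) :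
  act w (\prod_(v : W) F v) = \prod_(v : W) act w (F v).
Proof. by apply: big_morph; [exact: actM|exact: morph_mulg1]. Qed.

Let prod_const (x : T) : \prod_(w : W) x = x ^+ #|W|.
Proof. by rewrite (prodg_const W). Qed.

(** Multiply the cocycle identity over all w, reindexing w as v w in the last
factor. *)
Lemma average_cocycle2 (c : W -> W -> T) u v :
  (forall w, c u v * c (u * v) w = act u (c v w) * c u (v * w)) ->
  c u v ^+ #|W| * \prod_w c (u * v) w =
    act u (\prod_w c v w) * \prod_w c u w.
Proof.
move=> cE; rewrite act_prod [\prod_w c u w](reindex_inj (mulgI v))/=.
by rewrite -prod_const -!big_split /=; apply: eq_bigr => w _; exact: cE.
Qed.

(** Here a is a 1-cocycle modulo S: its m-th power is, modulo S, the coboundary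
of the inverse of the product of its values. *)
Lemma average_cocycle1 (a : W -> T) (S : set T) v : subgroup S ->
  (forall w, exists x, S x /\ a v * act v (a w) = x * a (v * w)) ->
  S ((\prod_w a w)^-1 * (a v ^+ #|W| * act v (\prod_w a w))).
Proof.
move=> [S1 SM _] /choice[x /all_and2[xS xE]].
rewrite act_prod -prod_const -big_split /=.
rewrite [X in _ * X](eq_bigr (fun w => x w * a (v * w))); last first.
  by move=> w _; exact: xE.
rewrite big_split /= -(_ : \prod_w a w = \prod_w a (v * w)); last first.
  exact: (reindex_inj (mulgI v)).
set b := \prod_w a w; rewrite (_ : b^-1 * _ = \prod_w x w); last first.
  by rewrite (mulTC b^-1) mulgK.
by apply: big_ind => // w _; exact: xS.
Qed.

End Averaging.

(** * Full subgroups of an extension by a torus *)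

(** A code is allowed to be a relation because the same conjugacy class gets a
code from each choice of a good representative. *)
Lemma card_le_finType (X : choiceType) (F : finType) (A : set X)
    (code : X -> F -> Prop) :
  (forall x, A x -> exists f, code x f) ->
  (forall x y f, A x -> A y -> code x f -> code y f -> x = y) ->
  (A #<= `I_#|F|)%card.
Proof.
move=> ex inj.
have [->|/set0P[x0 Ax0]] := eqVneq A set0; first exact: card_ge0.
have [f0 _] := ex _ Ax0.
pose h x := xget f0 (code x).
have hP x : A x -> code x (h x).
  by move=> /ex[f xf]; rewrite /h; case: xgetP => [//|/(_ f)].
pose rank x : nat := enum_rank (h x).
have /inj_card_eq/card_eqPle[_ +] : {in A &, injective rank}.
  move=> x y /set_mem Ax /set_mem Ay /val_inj/enum_rank_inj hxy.
  by apply: inj (hP x Ax) _ => //; rewrite hxy; exact: hP.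
move/card_le_trans; apply; apply: subset_card_le => _ [x Ax <-].
exact: ltn_ord.
Qed.

Section Extension.
Variables (R : realType) (T G : topologicalGroupType) (W : finGroupType).
Variables (iota : T -> G) (proj : G -> W).
Hypothesis E : torus_extension R iota proj.
Local Open Scope group_scope.

Let act := wact iota proj.
Let m := #|W|.
Let iotaM := ext_iotaM E.
Let projM := ext_projM E.
Let iotaI := ext_iota_inj E.
Let iota1 := morph_mulg1 iotaM.
Let iotaV := morph_mulgV iotaM.
Let projV := morph_mulgV projM.
Let actV w : {morph act w : t / t^-1} := morph_mulgV (wact_morph E w).
Let actX w n : {morph act w : t / t ^+ n} := morph_mulgX n (wact_morph E w).
Let mulTC : commutative (@mulg T) := torus_mulgC E.

Let m_gt0 : (0 < m)%N.
Proof. by apply/card_gt0P; exists 1. Qed.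

Lemma proj_iota t : proj (iota t) = 1.
Proof. by have : range iota (iota t) by []; rewrite (ext_exact E). Qed.

Lemma lift_ker g : proj g = 1 -> exists t, iota t = g.
Proof.
move=> g1; have : (proj @^-1` [set 1]) g by [].
by rewrite -(ext_exact E) => -[t _ <-]; exists t.
Qed.

Lemma mul_iota g t : g * iota t = iota (act (proj g) t) * g.
Proof. by rewrite (wactE E) mulgVK. Qed.

Lemma proj_fibre_closed w : closed (proj @^-1` [set w]).
Proof.
rewrite -openC (_ : ~` _ = \bigcup_(v in [set~ w]) (proj @^-1` [set v])).
  by apply: bigcup_open => v _; exact: ext_proj_continuous E v.
apply/seteqP; split=> [g gw|g [v vw gv]]; first by exists (proj g).
by move=> gw; apply: vw; rewrite -gv.
Qed.

Lemma iota_closed (S : set T) : closed S -> closed (iota @` S).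
Proof.
rewrite -openC => /(ext_iota_embedding E)[V oV VS].
have -> : iota @` S = proj @^-1` [set 1] `&` ~` V.
  apply/seteqP; split=> [_ [t St <-]|g [/lift_ker[t <-] Vt]].
    split; first exact: proj_iota.
    by move=> Vt; have : (iota @^-1` V) t by []; rewrite VS.
  exists t => //; apply: contrapT => St; apply: Vt.
  by have : (~` S) t by []; rewrite -VS.
by apply: closedI; [exact: proj_fibre_closed|exact: open_closedC].
Qed.

(** Divide a section s by m-th roots beta of the averaged cocycle b. The cocycle
c of the new section satisfies c^m = 1, because c^m and the coboundary of b
cancel. *)
Lemma section_torsion_cocycle : exists s : W -> G,
  (forall w, proj (s w) = w) /\
  forall u v, exists2 t, torsion T m t & s u * s v = iota t * s (u * v).
Proof.
have [s sE] := choice (ext_proj_surj E).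
have /choice[c' cE'] (uv : W * W) : exists t,
    iota t = s uv.1 * s uv.2 * (s (uv.1 * uv.2))^-1.
  by apply: lift_ker; rewrite !projM projV !sE mulgV.
pose c u v := c' (u, v).
have cE u v : s u * s v = iota (c u v) * s (u * v) by rewrite cE' mulgVK.
have cocycle u v w : c u v * c (u * v) w = act u (c v w) * c u (v * w).
  apply: iotaI; rewrite !iotaM; apply: (mulIg (s (u * v * w))).
  transitivity (s u * s v * s w); first by rewrite -mulgA -cE mulgA -cE.
  rewrite -(mulgA u) -(mulgA (iota _)) -cE (mulgA (iota _)).
  have := mul_iota (s u) (c v w); rewrite sE => <-.
  by rewrite -(mulgA (s u) (iota _)) -cE mulgA.
pose b u := \prod_w c u w.
have /choice[beta betaE] u : exists t, t ^+ m = b u.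
  exact: torus_root (ext_torus E) m_gt0.
exists (fun u => (iota (beta u))^-1 * s u); split=> [w|u v].
  by rewrite projM projV proj_iota invg1 mul1g sE.
exists ((beta u)^-1 * act u (beta v)^-1 * c u v * beta (u * v)).
  have := average_cocycle2 mulTC (wact_morph E) (cocycle u v).
  have mulX (x y : T) : (x * y) ^+ m = x ^+ m * y ^+ m by exact: expgMn.
  rewrite /torsion /= !mulX !expgVn !betaE -/m -/(b _) -/(b _) -/(b _).
  rewrite actV expgVn -actX betaE -!mulgA => ->.
  by rewrite mulKg mulVg.
have := mul_iota (s u) (beta v)^-1; rewrite sE iotaV => su_beta.
rewrite !iotaM !iotaV !mulgA mulgK -(mulgA (_ * _) (iota (c u v))) -cE.
by rewrite -!mulgA; congr (_ * _); rewrite !mulgA su_beta.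
Qed.

(** Over each w the union is a translate of the closed set iota(S), and the
fibres of the projection are finitely many closed sets. *)
Lemma closed_union_cosets (S : set T) (s : W -> G) : closed S ->
  closed [set g | exists2 t, S t & g = iota t * s (proj g)].
Proof.
move=> clS; rewrite (_ : [set g | _] = \bigcup_(w in [set: W])
    (proj @^-1` [set w] `&` (fun g => g * (s w)^-1) @^-1` (iota @` S))).
  apply: closed_bigcup => [|w _]; first exact: finite_finset.
  apply: closedI; first exact: proj_fibre_closed.
  apply: preimage_closed (iota_closed clS) => g _.
  apply: (@continuous2_cvg _ _ _ _ _ _ (fun g : G => g) (fun=> (s w)^-1)).
  - exact: (mulg_continuous (g, (s w)^-1)).
  - exact: cvg_id.
  - exact: cst_continuous.
apply/seteqP; split=> [g [t St gE]|g [w _ [<- [t St tE]]]].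
  by exists (proj g) => //; split=> //; exists t => //; rewrite {1}gE mulgK.
by exists t => //; rewrite tE mulgVK.
Qed.

Lemma full_subgroup_of_section (S : set T) (s : W -> G) :
  WSub iota proj S -> (forall w, proj (s w) = w) ->
  (forall u v, exists2 t, S t & s u * s v = iota t * s (u * v)) ->
  exists2 H, full_subgroup proj H & trace iota H = S.
Proof.
move=> [[[S1 SM SV] clS] SW] sE sM.
(* The section is not normalized: s 1 is an element of S, possibly not 1. *)
have [t0 St0 s1] : exists2 t, S t & s 1 = iota t.
  by have [t St] := sM 1 1; rewrite mulg1 => /mulIg; exists t.
pose H := [set g | exists2 t, S t & g = iota t * s (proj g)].
exists H; last first.
  apply/seteqP; split=> t.
    by move=> [x Sx]; rewrite proj_iota s1 -iotaM => /iotaI ->; exact: SM.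
  move=> St; exists (t * t0^-1); first by apply: SM => //; exact: SV.
  by rewrite proj_iota s1 -iotaM mulgVK.
have Hs w : H (s w) by exists 1 => //; rewrite sE iota1 mul1g.
have HS t : S t -> H (iota t).
  move=> St; exists (t * t0^-1); first by apply: SM => //; exact: SV.
  by rewrite proj_iota s1 -iotaM mulgVK.
have HM g h : H g -> H h -> H (g * h).
  move=> [x Sx gE] [y Sy hE]; have [t St tE] := sM (proj g) (proj h).
  exists (x * act (proj g) y * t).
    by apply: (SM) => //; apply: SM => //; exact: SW.
  have := mul_iota (s (proj g)) y; rewrite sE => gy.
  rewrite projM iotaM -[in RHS]mulgA -tE {1}gE {1}hE iotaM.
  by rewrite !mulgA -(mulgA (iota x) (s _)) gy !mulgA.
split; last first.
  by apply/seteqP; split=> // w _; exists (s w).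
split; last exact: closed_union_cosets.
split=> //; first by rewrite -iota1; exact: HS.
move=> g [x Sx gE].
have [t St tE] := sM (proj g)^-1 (proj g).
have -> : g^-1 = iota (t * t0)^-1 * (s (proj g)^-1 * iota x^-1).
  apply: (mulIg g); rewrite mulVg {2}gE [iota x^-1]iotaV -!mulgA mulKg.
  by rewrite tE mulVg s1 -!iotaM mulVg iota1.
apply: (HM); first by apply/HS/SV/SM.
by apply: (HM) => //; exact/HS/SV.
Qed.

Lemma conj_full_subgroup (H : set G) g :
  full_subgroup proj H -> full_subgroup proj [set h ^ g | h in H].
Proof.
move=> [sH fullH].
have -> : [set h ^ g | h in H] = (fun x => g * x * g^-1) @^-1` H.
  apply/seteqP; split=> [_ [h Hh <-]|x Hx] /=.
    by rewrite conjgE !mulgA mulgV mul1g mulgK.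
  by exists (g * x * g^-1) => //; rewrite conjgE !mulgA mulVg mul1g mulgVK.
split.
  apply: morph_preimage_closed_subgroup sH; last first.
    by move=> x y; rewrite !mulgA mulgVK.
  move=> x; apply: (@continuous2_cvg _ _ _ _ _ _ (fun x => g * x) (fun=> g^-1)).
  - exact: (mulg_continuous (g * x, g^-1)).
  - apply: (@continuous2_cvg _ _ _ _ _ _ (fun=> g) (fun x : G => x)).
    + exact: (mulg_continuous (g, x)).
    + exact: cst_continuous.
    + exact: cvg_id.
  - exact: cst_continuous.
apply/seteqP; split=> // w _.
have [h Hh hw] : (proj @` H) (proj g * w * (proj g)^-1) by rewrite fullH.
exists (g^-1 * h * g).
  by rewrite /preimage /= !mulgA mulgV mul1g mulgK.
by rewrite !projM projV hw !mulgA mulVg mul1g mulgVK.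
Qed.

Lemma conj_class_conj (H : set G) g :
  conj_class [set h ^ g | h in H] = conj_class H.
Proof.
have conjK (k : G) : [set h ^ k | h in [set h ^ g | h in H]] =
    [set h ^ (g * k) | h in H].
  apply/seteqP; split=> [_ [_ [h Hh <-] <-]|_ [h Hh <-]].
    by exists h; rewrite ?conjgM.
  by exists (h ^ g); rewrite ?conjgM//; exists h.
apply/seteqP; split=> [_ [k _ <-]|_ [k _ <-]].
  by exists (g * k); rewrite ?conjK.
by exists (g^-1 * k); rewrite ?conjK ?mulKVg.
Qed.

(** H and H0 define lifts of W that differ by a 1-cocycle a' modulo their common
trace. Let beta be an m-th root of the product b of the values of a'.
Conjugation by beta replaces a'(v) by beta^-1 a'(v) v(beta), whose m-th power is
b^-1 a'(v)^m v(b), and this lies in the trace by [average_cocycle1]. *)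
Lemma conj_class_torsion (H H0 : set G) (s0 : W -> G) :
  full_subgroup proj H -> full_subgroup proj H0 ->
  trace iota H = trace iota H0 -> (forall w, H0 (s0 w) /\ proj (s0 w) = w) ->
  exists H', [/\ full_subgroup proj H', trace iota H' = trace iota H,
    conj_class H' = conj_class H &
    forall w, exists a, H' (iota a * s0 w) /\ trace iota H (a ^+ m)].
Proof.
move=> fH fH0 HH0 /all_and2[H0s0 s0E].
have [[[H1 HM HV] _] HW] := fH; have [[[_ H0M H0V] _] _] := fH0.
have /choice[a' a'P] w : exists a, H (iota a * s0 w).
  have [h Hh hw] : (proj @` H) w by rewrite HW.
  have [a aE] : exists a, iota a = h * (s0 w)^-1.
    by apply: lift_ker; rewrite projM projV s0E hw mulgV.
  by exists a; rewrite aE mulgVK.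
have cocycle v w : exists x, trace iota H x /\
    a' v * act v (a' w) = x * a' (v * w).
  exists (a' v * act v (a' w) * (a' (v * w))^-1); rewrite mulgVK; split=> //.
  have [sg sgE] : exists sg, iota sg = s0 v * s0 w * (s0 (v * w))^-1.
    by apply: lift_ker; rewrite !projM projV !s0E mulgV.
  have Hsg : trace iota H sg.
    by rewrite HH0 /trace /= sgE; apply: (H0M); [exact: H0M|exact: H0V].
  have av : s0 v * iota (a' w) = iota (act v (a' w)) * s0 v.
    by rewrite mul_iota s0E.
  have key : H (iota (a' v * act v (a' w) * sg * (a' (v * w))^-1)).
    rewrite (_ : iota _ = (iota (a' v) * s0 v) * (iota (a' w) * s0 w) *
        (iota (a' (v * w)) * s0 (v * w))^-1).
      by apply: (HM); [exact: HM|exact: HV].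
    rewrite !iotaM sgE iotaV invgM !mulgA -(mulgA _ (s0 v) (iota _)) av.
    by rewrite !mulgA.
  rewrite -mulgA (mulTC sg) mulgA iotaM in key.
  rewrite /trace /= -(mulgK (iota sg) (iota _)).
  by apply: (HM) => //; exact: HV.
have trS : subgroup (trace iota H) by have [[]] := trace_WSub E fH.
pose b := \prod_w a' w.
have [beta betaE] := torus_root b (ext_torus E) m_gt0.
exists [set h ^ iota beta | h in H]; split.
- exact: conj_full_subgroup.
- apply: (trace_conj E fH); exact: imageT.
- exact: conj_class_conj.
move=> v; exists (beta^-1 * (a' v * act v beta)); split.
  exists (iota (a' v) * s0 v) => //.
  have := mul_iota (s0 v) beta; rewrite s0E => sb.
  by rewrite conjgE !iotaM iotaV -!mulgA sb.
have mulX (x y : T) : (x * y) ^+ m = x ^+ m * y ^+ m by exact: expgMn.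
rewrite !mulX expgVn -actX betaE.
exact: (average_cocycle1 mulTC (wact_morph E) trS (cocycle v)).
Qed.

(** Over each w, H and H' are single cosets of their common trace S, so they
agree over w once they contain lifts that differ by an element of S. *)
Lemma full_subgroup_sub (H H' : set G) (s0 : W -> G) :
  full_subgroup proj H -> full_subgroup proj H' ->
  trace iota H = trace iota H' -> (forall w, proj (s0 w) = w) ->
  (forall w, exists a a', [/\ H (iota a * s0 w), H' (iota a' * s0 w) &
     trace iota H (a * a'^-1)]) -> H `<=` H'.
Proof.
move=> [[[H1 HM HV] _] _] [[[_ HM' _] _] _] HH' s0E hs h Hh.
have [a [a' [Ha Ha' aa']]] := hs (proj h).
have [x xE] : exists x, iota x = h * (iota a * s0 (proj h))^-1.
  by apply: lift_ker; rewrite projM projV projM proj_iota mul1g s0E mulgV.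
have -> : h = iota x * (iota (a * a'^-1) * (iota a' * s0 (proj h))).
  by rewrite iotaM iotaV (mulgA (_ * _) (iota a')) mulgVK xE mulgVK.
have Hx : trace iota H x by rewrite /trace /= xE; apply: (HM) => //; exact: HV.
by apply: (HM'); [rewrite HH' in Hx|apply: (HM') => //; rewrite HH' in aa'].
Qed.

Lemma full_subgroups_bounded : exists N : nat, forall L,
  ([set C | full_classes proj C /\ dual_trace R iota C = L] #<= `I_N)%card.
Proof.
have [r kernels] := torus_subgroup_kernels (ext_torus E).
have [zeta zeta1 rootsE] := circle_roots_of_unity R m_gt0.
exists #|{ffun W * 'I_r -> 'I_m}| => L; set A := (X in (X #<= _)%card).
have [->|/set0P[C0 [[H0 fH0 <-]]]] := eqVneq A set0; first exact: card_ge0.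
rewrite (dual_traceE E fH0) => dL0.
have [chi cchi trH0] := kernels _ (trace_WSub E fH0).1.
have trE H : full_subgroup proj H -> dagger R (trace iota H) = L ->
    trace iota H = trace iota H0.
  move=> fH dL; have [xi cxi trH] := kernels _ (trace_WSub E fH).1.
  apply/seteqP; split=> t Ht.
    rewrite trH0 => j; suff [_] : dagger R (trace iota H) (chi j) by exact.
    by rewrite dL -dL0; split=> // s; rewrite {1}trH0; exact.
  rewrite trH => j; suff [_] : dagger R (trace iota H0) (xi j) by exact.
  by rewrite dL0 -dL; split=> // s; rewrite {1}trH; exact.
have [_ fullH0] := fH0.
have /choice[s0 s0P] w : exists g, H0 g /\ proj g = w.
  by have [g] : (proj @` H0) w by [rewrite fullH0|]; exists g.
(* The code of a class records the values of the r characters chi j at the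
   torus elements a that lead from H0 to a representative with a^m in the
   trace; zeta generates the m-th roots of unity. *)
pose code (C : set (set G)) (f : {ffun W * 'I_r -> 'I_m}) := exists H,
  [/\ C = conj_class H, full_subgroup proj H, trace iota H = trace iota H0 &
      forall w, exists a, H (iota a * s0 w) /\
        forall j, chi j a = zeta ^+ f (w, j)].
apply: (card_le_finType (code := code)).
  move=> C [[H fH <-]]; rewrite (dual_traceE E fH) => /(trE _ fH) HH0.
  have [H' [fH' HH' CH' /choice[a aP]]] := conj_class_torsion fH fH0 HH0 s0P.
  have /choice[f fE] (wj : W * 'I_r) : exists k : 'I_m,
      chi wj.2 (a wj.1) = zeta ^+ k.
    apply: rootsE; rewrite -(morph_mulgX _ (cchi _).2).
    by have := (aP wj.1).2; rewrite HH0 trH0 => /(_ wj.2).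
  exists [ffun wj => f wj], H'; split=> //; first by rewrite HH'.
  move=> w; exists (a w); split=> [|j]; first exact: (aP w).1.
  by rewrite ffunE (fE (w, j)).
have sub (H1 H2 : set G) (f : {ffun W * 'I_r -> 'I_m}) :
  full_subgroup proj H1 -> full_subgroup proj H2 ->
  trace iota H1 = trace iota H0 -> trace iota H2 = trace iota H0 ->
  (forall w, exists a, H1 (iota a * s0 w) /\
        forall j, chi j a = zeta ^+ f (w, j)) ->
  (forall w, exists a, H2 (iota a * s0 w) /\
        forall j, chi j a = zeta ^+ f (w, j)) -> H1 `<=` H2.
  move=> fH1 fH2 H10 H20 P1 P2.
  apply: (@full_subgroup_sub _ _ s0) => // [|w|w].
  - by rewrite H10.
  - by have [] := s0P w.
  have [[a1 [Ha1 a1E]] [a2 [Ha2 a2E]]] := (P1 w, P2 w).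
  exists a1, a2; split=> //; rewrite H10 trH0 => j.
  by rewrite (cchi j).2 (morph_mulgV (cchi j).2) a1E a2E mulgV.
move=> _ _ f _ _ [H1 [-> fH1 H10 P1]] [H2 [-> fH2 H20 P2]].
by congr conj_class; apply/seteqP; split; exact: (sub _ _ f).
Qed.

End Extension.

Theorem corollary3p5 (R : realType) (T G : topologicalGroupType)
    (W : finGroupType) (iota : T -> G) (proj : G -> W)
    (E : torus_extension R iota proj) :
  (exists2 n : nat, (1 <= n)%N &
     forall S : set T, WSub iota proj S -> torsion T n `<=` S ->
       exists H : set G, [/\ full_subgroup proj H, trace iota H = S &
         dual_trace R iota (conj_class H) = dagger R S]) /\
  (exists N : nat,
     forall L : set {ptws T -> circle R}, WSub_char R iota proj L ->
       ([set C | full_classes proj C /\ dual_trace R iota C = L]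
          #<= `I_N)%card).
Proof.
split; last first.
  have [N NP] := full_subgroups_bounded E; exists N => L _; exact: NP.
have [s [sE sM]] := section_torsion_cocycle E.
exists #|W|; first by apply/card_gt0P; exists 1%g.
move=> S WS TS.
have [|H fH trH] := full_subgroup_of_section E WS sE.
  by move=> u v; have [t tm ->] := sM u v; exists t => //; exact: TS.
by exists H; rewrite (dual_traceE E fH) trH.
Qed.
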